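(* Let $n \geq 2$ be an integer. Then $\mathbb{G}_n$ contains a pair $(g,\alpha)$ satisfying the following: if $n$ is odd, $\alpha = q_n^{\frac{n-1}{2}}$ and $r_{n-1}^{\frac{n-1}{2}} \in \mathrm{supp}(g)$; if $n$ is even, $\alpha = p_n$ and $s_{n-1} \in \mathrm{supp}(g)$.
   Context: Let $\sigma \subset \mathbb{R}^2$ be the cone generated by $(0,1)$ and $(4,-3)$; its dual $\sigma^\vee$ is generated by $(1,0)$ and $(3,4)$. Put $\sigma_{\mathbb{Z}} := \sigma^\vee \cap \mathbb{Z}^2$, a semigroup generated by $(1,0),(3,4),(1,1)$, and $S := \mathbb{C}[\sigma_{\mathbb{Z}}] = \mathbb{C}[u,u^3v^4,uv] \subset \mathbb{C}[u,v]$. A point $(a,b)\in\sigma_{\mathbb{Z}}$ is identified with the monomial $u^av^b \in S$. Divisibility of monomials of $S$ is always taken in $S$. For an integer $n>0$ let $J_n := \langle u-1,\, u^3v^4-1,\, uv-1\rangle^{n+1} \subset S$. Let $\preceq$ be the total ordering on monomials of $S$ associated to the matrix $\begin{pmatrix} 2 & -1 \\ 1 & 1\end{pmatrix}$: for $\alpha\neq\beta$ in $\sigma_{\mathbb{Z}}$, $\beta \prec \alpha$ iff $(2,-1)\cdot(\alpha-\beta)>0$, or $(2,-1)\cdot(\alpha-\beta)=0$ and $(1,1)\cdot(\alpha-\beta)>0$. It is a monomial ordering on $S$. For $0\ne f\in S$, $\mathrm{lm}_\preceq(f)$ and $\mathrm{lc}_\preceq(f)$ are the leading monomial and leading coefficient,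 and $\mathrm{supp}(f)$ is the set of monomials with nonzero coefficient in $f$. A Gröbner basis of an ideal $I$ is a finite set $\{g_1,\dots,g_t\}$ of nonzero elements of $I$ such that for every $0\ne f\in I$ some $\mathrm{lm}_\preceq(g_i)$ divides $\mathrm{lm}_\preceq(f)$ in $S$; it is reduced if $\mathrm{lc}_\preceq(g_i)=1$ for all $i$ and no monomial of $\mathrm{supp}(g_i)$ is divisible by $\mathrm{lm}_\preceq(g_j)$ for $j\ne i$. Every nonzero ideal of $S$ has a unique reduced Gröbner basis. Let $\mathbb{G}_n$ (the marked Gröbner basis) be the set of pairs $(g,\mathrm{lm}_\preceq(g))$ with $g$ in the reduced Gröbner basis of $J_n$ with respect to $\preceq$. For each integer $n>0$ define points of $\sigma_{\mathbb{Z}}$ as follows. If $n$ is odd: $p_n := (\frac{n+3}{2},0)$; $q_n^0 := (\frac{n+3}{2},1)+\frac{n-1}{2}(1,2)$, $q_n^i := q_n^0 - i(1,2)$ for $0\le i\le \frac{n-1}{2}$; $r_n^0 := q_n^0+(0,1)$, $r_n^j := r_n^0 + j(1,2)$ for $0\le j\le\frac{n-1}{2}$; $s_n := \frac{n+1}{2}(3,4)$. If $n$ is even: $p_n := (\frac{n+2}{2},0)$; $q_n^0 := (\frac{n+2}{2},0)+\frac{n}{2}(1,2)$, $q_n^i := q_n^0 - i(1,2)$ for $0\le i\le\frac{n-2}{2}$; $r_n^0 := q_n^0+(0,1)$, $r_n^j := r_n^0+j(1,2)$ for $0\le j\le\frac{n}{2}$; $s_n := \frac{n+2}{2}(3,4)$.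 *)

(* Defs.v *)
From HB Require Import structures.
From mathcomp Require Import all_boot all_order all_algebra.
From mathcomp Require Import finmap.
From mathcomp Require Import zify.
From mathcomp Require Import reals complex.
From mathcomp.multinomials Require Import monalg.

Set Implicit Arguments.
Unset Strict Implicit.
Unset Printing Implicit Defensive.

Import Order.TTheory GRing.Theory Num.Theory.

Local Open Scope fset_scope.
Local Open Scope ring_scope.

Definition ideal_span (A : comNzRingType) (X : A -> Prop) : A -> Prop :=
  fun f => exists s : seq (A * A),
    (forall x, x \in s -> X x.2) /\ f = \sum_(x <- s) x.1 * x.2.

Lemma ideal_spanB (A : comNzRingType) (X : A -> Prop) (f g : A) :
  ideal_span X f -> ideal_span X g -> ideal_span X (f - g).
Proof.
move=> [s [hs ->]] [t [ht ->]].
exists (s ++ [seq (- x.1, x.2) | x <- t]); split.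
  move=> x; rewrite mem_cat => /orP[/hs //|/mapP[y /ht hy ->]//].
rewrite big_cat big_map /=; congr (_ + _).
by rewrite -sumrN; apply: eq_bigr => x _; rewrite mulNr.
Qed.

Definition ideal_mul (A : comNzRingType) (I J : A -> Prop) : A -> Prop :=
  ideal_span (fun f => exists a b, [/\ I a, J b & f = a * b]).

Definition ideal_exp (A : comNzRingType) (I : A -> Prop) (k : nat) : A -> Prop :=
  iter k (ideal_mul I) (fun _ => True).

Definition dotZ (p q : int * int) : int := p.1 * q.1 + p.2 * q.2.

(* The dual of the cone generated by (0,1) and (4,-3): a linear form is
   nonnegative on that cone iff it is nonnegative on the two generators. *)
Definition in_dual_cone (p : int * int) : bool :=
  (0 <= dotZ (0, 1) p) && (0 <= dotZ (4, -3) p).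

Record sigmaZ := SigmaZ { sigma_pt : int * int; _ : in_dual_cone sigma_pt }.

HB.instance Definition _ := [isSub for sigma_pt].
HB.instance Definition _ := [Choice of sigmaZ by <:].

Lemma sigmaZP (a : sigmaZ) :
  0 <= (sigma_pt a).2 /\ 3 * (sigma_pt a).2 <= 4 * (sigma_pt a).1.
Proof. by case: a => -[x y] /=; rewrite /in_dual_cone /dotZ /=; lia. Qed.

Fact sigma0_subproof : in_dual_cone (0, 0). Proof. by []. Qed.
Definition sigma0 := SigmaZ sigma0_subproof.

Fact sigmaD_subproof (a b : sigmaZ) : in_dual_cone (sigma_pt a + sigma_pt b).
Proof.
move: (sigmaZP a) (sigmaZP b); case: a b => -[x y] ha [[z t] hb] /=.
by rewrite /in_dual_cone /dotZ /=; lia.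
Qed.
Definition sigmaD (a b : sigmaZ) := SigmaZ (sigmaD_subproof a b).

Fact sigmaDA : associative sigmaD.
Proof. by move=> a b c; apply: val_inj; rewrite /= addrA. Qed.
Fact sigma0D : left_id sigma0 sigmaD.
Proof. by move=> a; apply: val_inj; rewrite /= add0r. Qed.
Fact sigmaD0 : right_id sigma0 sigmaD.
Proof. by move=> a; apply: val_inj; rewrite /= addr0. Qed.
Fact sigmaD_eq0 a b : sigmaD a b = sigma0 -> a = sigma0 /\ b = sigma0.
Proof.
move=> /(congr1 sigma_pt); move: (sigmaZP a) (sigmaZP b).
case: a b => -[x y] ha [[z t] hb] /= h1 h2 [e1 e2].
by split; apply: val_inj; congr pair; lia.
Qed.
Fact sigmaDC : commutative sigmaD.
Proof. by move=> a b; apply: val_inj; rewrite /= addrC. Qed.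

(* monalg writes monoids of monomials multiplicatively: [mmul a b] is the
   monomial with exponent a + b. *)
HB.instance Definition _ := Choice_isMonomialDef.Build sigmaZ
  sigmaDA sigma0D sigmaD0 sigmaD_eq0.
HB.instance Definition _ := MonomialDef_isConomialDef.Build sigmaZ sigmaDC.

(* [prec b a] means b < a in the order of the matrix (2 -1; 1 1). *)
Definition prec (b a : sigmaZ) : bool :=
  let d := sigma_pt a - sigma_pt b in
  (0 < dotZ (2, -1) d) || ((dotZ (2, -1) d == 0) && (0 < dotZ (1, 1) d)).

Definition preceq (b a : sigmaZ) : bool := (b == a) || prec b a.

Fact prec_irr : irreflexive prec.
Proof. by case=> -[x y] h; rewrite /prec /dotZ /=; lia. Qed.
Fact prec_trans : transitive prec.
Proof.
by case=> -[x y] h [[z t] h'] [[v w] h'']; rewrite /prec /dotZ /=; lia.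
Qed.
Fact prec_total a b : a != b -> prec a b || prec b a.
Proof.
case: a b => -[x y] h [[z t] h']; apply: contraR.
rewrite -val_eqE /= xpair_eqE /prec /dotZ /=; lia.
Qed.

Fact sigma_display : Order.disp_t. Proof. exact: Order.Disp tt tt. Qed.
HB.instance Definition _ := @Order.LtOrder.Build sigma_display sigmaZ
  preceq prec (fun a b => if prec a b then a else b)
  (fun a b => if prec a b then b else a)
  (fun _ _ => erefl) (fun _ _ => erefl) (fun _ _ => erefl)
  prec_irr prec_trans prec_total.

Fact sigma_le0 (a : sigmaZ) : (sigma0 <= a)%O.
Proof.
rewrite le_eqVlt; move: (sigmaZP a); case: a => -[x y] h /=.
rewrite -val_eqE /= /Order.lt /= /prec /dotZ /= xpair_eqE; lia.
Qed.

HB.instance Definition _ :=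
  Order.hasBottom.Build sigma_display sigmaZ sigma_le0.

Lemma sigma_ltM (c a b : sigmaZ) : (a < b)%O -> (mmul c a < mmul c b)%O.
Proof. by rewrite /Order.lt /= /prec /= opprD addrACA subrr add0r. Qed.

Definition sdvd (a b : sigmaZ) : Prop := exists c : sigmaZ, b = mmul a c.

Section Groebner.
Variable R : realType.

Notation S := {malg R[i][sigmaZ]}.

(* Also defined at f = 0, where it is the bottom monomial 1. *)
Definition lm (f : S) : sigmaZ := \big[Order.max/Order.bottom]_(m <- msupp f) m.

Definition lc (f : S) : R[i] := f@_(lm f).

Definition groebner_basis (I : S -> Prop) (G : {fset S}) : Prop :=
  (forall g, g \in G -> g != 0 /\ I g) /\
  (forall f, f != 0 -> I f -> exists2 g, g \in G & sdvd (lm g) (lm f)).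

Definition reduced_groebner_basis (I : S -> Prop) (G : {fset S}) : Prop :=
  [/\ groebner_basis I G,
      forall g, g \in G -> lc g = 1
    & forall g h, g \in G -> h \in G -> h != g ->
        forall m, m \in msupp g -> ~ sdvd (lm h) m].

(* By [reduced_groebner_basis_uniq] and [JB] below, at most one such G
   exists when I is [J n]. *)
Definition marked_groebner_basis (I : S -> Prop) (x : S * sigmaZ) : Prop :=
  exists G, [/\ reduced_groebner_basis I G, x.1 \in G & x.2 = lm x.1].

Definition mon_u : sigmaZ := @SigmaZ (1, 0) isT.
Definition mon_u3v4 : sigmaZ := @SigmaZ (3, 4) isT.
Definition mon_uv : sigmaZ := @SigmaZ (1, 1) isT.

Definition J (n : nat) : S -> Prop :=
  ideal_exp
    (ideal_span (fun f => f \in [:: << mon_u >> - 1; << mon_u3v4 >> - 1;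
                                    << mon_uv >> - 1]))
    n.+1.

Definition supp (f : S) : {fset int * int} := [fset sigma_pt m | m in msupp f].

Lemma le_lm (f : S) m : m \in msupp f -> (m <= lm f)%O.
Proof. by move=> mf; exact: (@le_bigmax_seq _ _ _ _ _ _ xpredT id). Qed.

Lemma lm_supp (f : S) : f != 0 -> lm f \in msupp f.
Proof.
rewrite -msupp_eq0 => /fset0Pn[m mf].
rewrite -[_ \in _]/(lm f \in enum_fset (msupp f)) /lm.
have : m \in enum_fset (msupp f) by [].
elim: (enum_fset (msupp f)) m {mf} => [//|a s IH] m _; rewrite big_cons.
case: s IH => [_|b s IH]; first by rewrite big_nil max_l ?le0x ?mem_head.
have := IH b (mem_head _ _).
by rewrite maxEle; case: ifP => _ H; rewrite in_cons ?H ?eqxx ?orbT.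
Qed.

Lemma sdvd_le a b : sdvd a b -> (a <= b)%O.
Proof.
move=> [c ->]; have [->|c0] := eqVneq c sigma0; first by rewrite mulm1.
by apply: ltW; rewrite -[X in (X < _)%O]mulm1 sigma_ltM // lt_def c0 le0x.
Qed.

Lemma sdvd_anti a b : sdvd a b -> sdvd b a -> a = b.
Proof. by move=> /sdvd_le ab /sdvd_le ba; apply/le_anti/andP. Qed.

Lemma reduced_groebner_basis_uniq (I : S -> Prop) (G G' : {fset S}) :
  (forall f g, I f -> I g -> I (f - g)) ->
  reduced_groebner_basis I G -> reduced_groebner_basis I G' -> G = G'.
Proof.
move=> IB.
have sub (A B : {fset S}) : reduced_groebner_basis I A ->
    reduced_groebner_basis I B -> forall g, g \in A -> g \in B.
  move=> [[A0 AI] A1 Ar] [[B0 BI] B1 Br] g gA.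
  have [g0 Ig] := A0 g gA.
  have [g' g'B dg'] := BI g g0 Ig.
  have [g'0 Ig'] := B0 g' g'B.
  have [h hA dh] := AI g' g'0 Ig'.
  have hg : h = g.
    apply/eqP/negPn/negP => hg.
    apply: (Ar g h gA hA hg (lm g) (lm_supp g0)).
    by move: dh dg' => [c ->] [d ->]; exists (mmul c d); rewrite mulmA.
  have elm : lm g = lm g' by apply: sdvd_anti => //; rewrite -hg.
  suff -> : g = g' by [].
  apply/eqP; rewrite -subr_eq0; apply/negPn/negP => f0.
  have If := IB _ _ Ig Ig'.
  have fs := lm_supp f0; set f := g - g' in f0 If fs.
  have fne : lm f != lm g.
    apply: contraL fs => /eqP ->; rewrite -mcoeff_eq0 mcoeffB.
    by move: (A1 _ gA) (B1 _ g'B); rewrite /lc -elm => -> ->; rewrite subrr.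
  have := fsubsetP (msuppB_le g g') _ fs; rewrite in_fsetU => /orP[]; move=> fg.
    have [k kA dk] := AI f f0 If.
    have [kg|kg] := eqVneq k g; last exact: (Ar g k gA kA kg _ fg).
    move: fne; rewrite eq_le (le_lm fg) /=; apply/negP/negPn.
    by apply: sdvd_le; rewrite -kg.
  have [k kB dk] := BI f f0 If.
  have [kg|kg] := eqVneq k g'; last exact: (Br g' k g'B kB kg _ fg).
  move: fne; rewrite elm eq_le (le_lm fg) /=; apply/negP/negPn.
  by apply: sdvd_le; rewrite -kg.
by move=> hG hG'; apply/fsetP => g; apply/idP/idP; apply: sub.
Qed.

Lemma JB n f g : J n f -> J n g -> J n (f - g).
Proof. exact: ideal_spanB. Qed.
End Groebner.

Section Points.
Variable n : nat.

Definition pt_p : int * int :=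
  if odd n then ((n + 3)./2%:Z, 0) else ((n + 2)./2%:Z, 0).

Definition pt_q0 : int * int :=
  if odd n then ((n + 3)./2%:Z, 1) + (1, 2) *+ (n - 1)./2
  else ((n + 2)./2%:Z, 0) + (1, 2) *+ n./2.

Definition pt_q (i : nat) : int * int := pt_q0 - (1, 2) *+ i.

Definition pt_r0 : int * int := pt_q0 + (0, 1).

Definition pt_r (j : nat) : int * int := pt_r0 + (1, 2) *+ j.

Definition pt_s : int * int :=
  if odd n then (3, 4) *+ (n + 1)./2 else (3, 4) *+ (n + 2)./2.
End Points.

(* Main.v *)
Require Import Defs.
From mathcomp Require Import all_boot all_order all_algebra.
From mathcomp Require Import finmap reals complex.
From mathcomp.multinomials Require Import monalg.
From mathcomp Require Import boolp zify ring.

Local Open Scope fset_scope.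
Local Open Scope ring_scope.

Import Order.TTheory GRing.Theory Num.Theory.
(* [sdvd] is divisibility of monomials, not strict divisibility in nat. *)
Import Defs.

Set Implicit Arguments.
Unset Strict Implicit.

(** Why the theorem holds.  In the unimodular coordinates [level] = 2a - b and
[column] = b - a the semigroup is the set of pairs (c, w) with |2w| <= c, and
the order compares levels first, then columns.  J n is the (n+1)-st power of
the maximal ideal of the smooth point (1, 1, 1), so the quotient by it has
dimension (n+1)(n+2)/2, and a linear form on S vanishes on J n as soon as it is
f |-> sum of f_m F(m) for a function F of degree at most n on the semigroup.

Consider the initial segment of the order formed by the levels 0, ..., n and
the negative columns of level n+1 ([standard]).  Visited in the order
0, -1, 1, -2, 2, ... its columns contain n+1, n, n-1, ... points.  Hence Newton
interpolation, column by column, shows that the standard monomials are linearly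
independent modulo J n ([standard_free]).  Their number is (n+1)(n+2)/2, and
the quotient is spanned by that many monomials in u - 1 and uv - 1
([tspan_exp_cancel]), so the standard monomials form a basis of the quotient
([normal_form]).  Since they are an initial segment, they are exactly the
monomials that are not leading, and the reduced basis consists of the
differences between a minimal nonstandard monomial and its normal form
([corner_basis]).

The two parities of the statement describe one pair of points: the marked
monomial is the first point of level n+2 ([first_corner]), and the monomial
claimed in the support is the last point of level n ([last_standard]).  The
coefficient of the latter in the normal form of the former is a quotient of
values of the function of degree at most n that vanishes at every other
standard point.  That function is explicit, a product of affine forms, and it
does not vanish at [first_corner] ([separating_function]). *)

(** * Powers of ideals *)

Section Ideals.
Variable A : comNzRingType.
Implicit Types (I X : A -> Prop) (f g : A).

Lemma ideal_span_gen X f : X f -> ideal_span X f.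
Proof.
move=> Xf; exists [:: (1, f)]; split; last by rewrite big_seq1 mul1r.
by move=> x; rewrite inE => /eqP ->.
Qed.

Lemma ideal_spanD X f g : ideal_span X f -> ideal_span X g -> ideal_span X (f + g).
Proof.
move=> [s [sX ->]] [t [tX ->]]; exists (s ++ t); split; last by rewrite big_cat.
by move=> x; rewrite mem_cat => /orP[/sX|/tX].
Qed.

Lemma ideal_spanMl X f g : ideal_span X g -> ideal_span X (f * g).
Proof.
move=> [s [sX ->]]; exists [seq (f * x.1, x.2) | x <- s]; split.
  by move=> _ /mapP[x /sX Xx ->].
by rewrite big_map mulr_sumr; apply: eq_bigr => x _; rewrite mulrA.
Qed.

Lemma ideal_expD I k f g : ideal_exp I k f -> ideal_exp I k g -> ideal_exp I k (f + g).
Proof. by case: k => // k; apply: ideal_spanD. Qed.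

Lemma ideal_expMl I k f g : ideal_exp I k g -> ideal_exp I k (f * g).
Proof. by case: k => // k; apply: ideal_spanMl. Qed.

Lemma ideal_exp0 I k : ideal_exp I k 0.
Proof. by case: k => // k; exists [::]; rewrite big_nil. Qed.

Lemma ideal_expS I k f g : I f -> ideal_exp I k g -> ideal_exp I k.+1 (f * g).
Proof. by move=> If Ig; apply: ideal_span_gen; exists f, g. Qed.

Lemma ideal_exp_monomial I (f g : A) i j k :
  I f -> I g -> (k <= i + j)%N -> ideal_exp I k (f ^+ i * g ^+ j).
Proof.
move=> If Ig; elim: i k => [|i IHi] [|k] // le_k.
  rewrite mul1r; elim: j k le_k => // j IHj [|k] le_k.
    by rewrite exprS; apply: ideal_expS.
  by rewrite exprS; apply: ideal_expS => //; apply: IHj.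
by rewrite exprS -mulrA; apply: ideal_expS => //; apply: IHi.
Qed.
End Ideals.

(** * Finite differences and moments *)

Section Differences.
Variables (M : conomType) (K : comNzRingType).
Implicit Types (F G : M -> K) (k l : nat).

(** Over a semigroup, functions of degree less than [k] are those killed by all
[k]-fold finite differences.  This form is the one that the powers of an ideal
generated by differences [<< d >> - 1] detect. *)
Fixpoint diffs_vanish k F : Prop :=
  if k is k'.+1 then forall d, diffs_vanish k' (fun m => F (mmul d m) - F m)
  else forall m, F m = 0.

Lemma diffs_vanish_eq k F G : F =1 G -> diffs_vanish k F -> diffs_vanish k G.
Proof.
elim: k F G => [|k IHk] F G FG /= Fk => [m|d]; first by rewrite -FG.
by apply: IHk (Fk d) => m; rewrite !FG.
Qed.

Lemma diffs_vanish0 k : diffs_vanish k (fun=> 0).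
Proof.
elim: k => // k IHk d; apply: diffs_vanish_eq IHk => m.
by rewrite subrr.
Qed.

Lemma diffs_vanishD k F G :
  diffs_vanish k F -> diffs_vanish k G -> diffs_vanish k (fun m => F m + G m).
Proof.
elim: k F G => [|k IHk] F G /= Fk Gk => [m|d]; first by rewrite Fk Gk addr0.
by apply: diffs_vanish_eq (IHk _ _ (Fk d) (Gk d)) => m; ring.
Qed.

Lemma diffs_vanish_shift k F d :
  diffs_vanish k F -> diffs_vanish k (fun m => F (mmul d m)).
Proof.
elim: k F => [|k IHk] F /= Fk => [m|e]; first by rewrite Fk.
by apply: diffs_vanish_eq (IHk _ (Fk e)) => m; rewrite !mulmA [mmul d e]mulmC.
Qed.

Lemma diffs_vanishS k F : diffs_vanish k F -> diffs_vanish k.+1 F.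
Proof.
elim: k F => [|k IHk] F Fk d; first by move=> m; rewrite !Fk subrr.
exact: IHk (Fk d).
Qed.

Lemma diffs_vanishW k l F : (k <= l)%N -> diffs_vanish k F -> diffs_vanish l F.
Proof.
move=> /subnKC <-; elim: (l - k)%N => [|j IHj] Fk; first by rewrite addn0.
by rewrite addnS; apply/diffs_vanishS/IHj.
Qed.

(** Degrees add, and [diffs_vanish k] bounds the degree by [k - 1]: this is where
the predecessor comes from.  The induction rests on the Leibniz rule
D(FG)(m) = F(m) DG(m) + DF(m) G(dm). *)
Lemma diffs_vanishM k l F G : diffs_vanish k F -> diffs_vanish l G ->
  diffs_vanish (k + l).-1 (fun m => F m * G m).
Proof.
have [s] := ubnP (k + l); elim: s k l F G => // s IHs [|k] l F G le_s Fk Gl.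
  apply: diffs_vanish_eq (diffs_vanish0 _) => m.
  by rewrite Fk mul0r.
case: l Gl le_s => [|l] Gl le_s.
  apply: diffs_vanish_eq (diffs_vanish0 _) => m.
  by rewrite Gl mulr0.
rewrite addSn /= addnS => d.
have FdG : diffs_vanish (k + l) (fun m => F m * (G (mmul d m) - G m)).
  by have := IHs k.+1 l F _ _ Fk (Gl d); rewrite addSn; apply; lia.
have dFG : diffs_vanish (k + l) (fun m => (F (mmul d m) - F m) * G (mmul d m)).
  have := IHs k l.+1 _ _ _ (Fk d) (diffs_vanish_shift d Gl).
  by rewrite addnS; apply; lia.
by apply: diffs_vanish_eq (diffs_vanishD FdG dFG) => m; ring.
Qed.

(** [diffs_vanish 2] says that each factor is affine. *)
Lemma diffs_vanish_prod n (L : nat -> M -> K) :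
  (forall i, diffs_vanish 2 (L i)) ->
  diffs_vanish n.+1 (fun m => \prod_(i < n) L i m).
Proof.
move=> L2; elim: n => [|n IHn].
  by move=> d m; rewrite !big_ord0 subrr.
have := diffs_vanishM IHn (L2 n); rewrite addn2 succnK.
by apply: diffs_vanish_eq => m; rewrite big_ord_recr.
Qed.

Local Notation S := {malg K[M]}.

Definition moment F (f : S) : K := mmap idfun F f.

Lemma moment_sum F I (r : seq I) (P : pred I) (E : I -> S) :
  moment F (\sum_(i <- r | P i) E i) = \sum_(i <- r | P i) moment F (E i).
Proof. exact: raddf_sum. Qed.

Lemma momentB F : {morph moment F : f g / f - g}.
Proof. exact: raddfB. Qed.

Lemma momentU F c m : moment F << c *g m >> = c * F m.
Proof. exact: mmapU. Qed.

Lemma momentE F f : moment F f = \sum_(m <- msupp f) f@_m * F m.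
Proof. exact: mmapE. Qed.

Lemma malg_mulUU (c d : K) (k l : M) :
  << c *g k >> * << d *g l >> = << c * d *g mmul k l >> :> S.
Proof. by rewrite malgM_def fgmulUU. Qed.

Lemma malgUX (m m' : M) : << mmul m m' >> = << m >> * << m' >> :> S.
Proof. by rewrite malg_mulUU mul1r. Qed.

(** Multiplication by [<< d >> - 1] is adjoint to the difference operator of
[d]. *)
Lemma moment_subr1M F d f :
  moment F ((<< d >> - 1) * f) = moment (fun m => F (mmul d m) - F m) f.
Proof.
rewrite [f in LHS]monalgE mulr_sumr moment_sum momentE.
apply: eq_bigr => m _; rewrite mulrBl mul1r momentB malg_mulUU mul1r !momentU.
by rewrite mulrBr.
Qed.

(** Each factor of a product of [k] generators takes one difference of [F], and
[k] differences annihilate it. *)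
Lemma moment_ideal_exp (X : S -> Prop) k F f :
  (forall x, X x -> exists d, x = << d >> - 1) ->
  diffs_vanish k F -> ideal_exp (ideal_span X) k f -> moment F f = 0.
Proof.
move=> X1; elim: k F f => [|k IHk] F f Fk.
  by move=> _; rewrite momentE big1 // => m _; rewrite Fk mulr0.
move=> [s [sX ->]]; rewrite moment_sum big_seq big1 // => x /sX.
move=> [a [b [[t [tX ->]] Jb ->]]].
rewrite mulrC mulr_suml mulr_suml moment_sum big_seq big1 // => y /tX/X1[d ->].
rewrite (mulrC y.1) -!mulrA moment_subr1M.
by apply: IHk (Fk d) _; rewrite (mulrC b); do 2!apply: ideal_expMl.
Qed.
End Differences.

(** * Linear algebra modulo a subspace *)

Section Spanning.
Variables (K : fieldType) (V : lmodType K) (P : V -> Prop).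
Hypotheses (P0 : P 0) (PD : forall u v, P u -> P v -> P (u + v)).
Hypothesis PZ : forall a u, P u -> P (a *: u).

Lemma mod_sum I (r : seq I) (E : I -> V) : (forall i, P (E i)) -> P (\sum_(i <- r) E i).
Proof. by move=> PE; elim/big_ind: _. Qed.

Definition spanned_mod N (s : 'I_N -> V) (v : V) : Prop :=
  exists c : 'rV[K]_N, P (v - \sum_i c 0 i *: s i).

Lemma spanned_mod_base N (s : 'I_N -> V) v : P v -> spanned_mod s v.
Proof. by move=> Pv; exists 0; rewrite big1 ?subr0 // => i _; rewrite mxE scale0r. Qed.

Lemma spanned_modD N (s : 'I_N -> V) u v :
  spanned_mod s u -> spanned_mod s v -> spanned_mod s (u + v).
Proof.
move=> [c Pc] [d Pd]; exists (c + d); have := PD Pc Pd.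
rewrite addrACA -opprD -big_split /=; congr (P (_ - _)).
by apply: eq_bigr => i _; rewrite mxE scalerDl.
Qed.

Lemma spanned_modZ N (s : 'I_N -> V) a v : spanned_mod s v -> spanned_mod s (a *: v).
Proof.
move=> [c Pc]; exists (a *: c); have := PZ a Pc.
rewrite scalerBr scaler_sumr; congr (P (_ - _)).
by apply: eq_bigr => i _; rewrite mxE scalerA.
Qed.

Lemma spanned_mod_gen N (s : 'I_N -> V) i : spanned_mod s (s i).
Proof.
exists (delta_mx 0 i); rewrite (bigD1 i) //= mxE !eqxx scale1r big1 ?addr0 ?subrr //.
by move=> j ne_ji; rewrite mxE (negPf ne_ji) andbF scale0r.
Qed.

Lemma spanned_mod_sum N (s : 'I_N -> V) I (r : seq I) (E : I -> V) :
  (forall i, spanned_mod s (E i)) -> spanned_mod s (\sum_(i <- r) E i).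
Proof.
move=> sE; elim/big_ind: _ => //; first exact: spanned_mod_base.
exact: spanned_modD.
Qed.

(** Exchange by counting: when [N] vectors span the quotient, expressing [N]
independent ones in them gives a square matrix with trivial kernel.  It is
therefore invertible, and the independent vectors span as well. *)
Lemma free_spanned_mod N (s b : 'I_N -> V) v :
    (forall i, spanned_mod s (b i)) ->
    (forall c : 'rV[K]_N, P (\sum_i c 0 i *: b i) -> c = 0) ->
  spanned_mod s v -> spanned_mod b v.
Proof.
move=> /fin_all_exists[C PC] free_b [e Pe].
pose B := \matrix_(i < N, j < N) C i 0 j.
have BC (c : 'rV_N) : P (\sum_i c 0 i *: b i - \sum_j (c *m B) 0 j *: s j).
  have -> : \sum_j (c *m B) 0 j *: s j = \sum_i c 0 i *: \sum_j C i 0 j *: s j.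
    under eq_bigr do rewrite mxE scaler_suml.
    rewrite exchange_big; apply: eq_bigr => i _; rewrite scaler_sumr.
    by apply: eq_bigr => j _; rewrite scalerA mxE.
  rewrite -sumrB; apply: mod_sum => i; rewrite -scalerBr; exact: PZ.
have uB : B \in unitmx.
  rewrite -row_free_unit; apply: inj_row_free => c cB0; apply: free_b.
  have := BC c; rewrite cB0 [X in _ - X]big1 ?subr0 // => j _; by rewrite mxE scale0r.
exists (e *m invmx B).
have := PD Pe (PZ (-1) (BC (e *m invmx B))); rewrite mulmxKV // scaleN1r.
by congr P; rewrite opprB addrA subrK.
Qed.
End Spanning.

(** * Spanning the quotient by a power of the ideal of a point *)

Definition triangle (n : nat) : finType :=
  {p : 'I_n.+1 * 'I_n.+1 | (p.1 + p.2 <= n)%N}.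

Section TangentSpan.
Variables (K : fieldType) (A : comAlgType K) (P : A -> Prop).
Hypotheses (P0 : P 0) (PD : forall f g, P f -> P g -> P (f + g)).
Hypothesis PM : forall f g, P g -> P (f * g).
Variables (n : nat) (x z : A).
Hypothesis P_exp : forall i j, (n < i + j)%N -> P ((x - 1) ^+ i * (z - 1) ^+ j).

Let PZ a f : P f -> P (a *: f).
Proof. by move=> Pf; rewrite -mulr_algl; apply: PM. Qed.

(** The exponents range over a triangle; [enum_val] lists them, because matrices
are indexed by ordinals. *)
Definition tangent (t : 'I_#|triangle n|) : A :=
  (x - 1) ^+ (val (enum_val t)).1 * (z - 1) ^+ (val (enum_val t)).2.

Local Notation tspan := (spanned_mod P tangent).

Lemma tspan_tangent i j : tspan ((x - 1) ^+ i * (z - 1) ^+ j).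
Proof.
case: (leqP (i + j) n) => [le_ij|/P_exp]; last exact: spanned_mod_base.
have [lti ltj] : (i < n.+1 /\ j < n.+1)%N by lia.
have := spanned_mod_gen P0 tangent
  (enum_rank (exist _ (Ordinal lti, Ordinal ltj) le_ij : triangle n)).
by rewrite /tangent enum_rankK.
Qed.

Lemma tspanM h : (forall i j, tspan (h * ((x - 1) ^+ i * (z - 1) ^+ j))) ->
  forall f, tspan f -> tspan (h * f).
Proof.
move=> th f [c Pc]; rewrite -[f](subrK (\sum_i c 0 i *: tangent i)) mulrDr.
apply: (spanned_modD PD); first by apply: spanned_mod_base; apply: PM.
rewrite mulr_sumr; apply: (spanned_mod_sum P0 PD) => i.
by rewrite -scalerAr; apply: (spanned_modZ PZ); apply: th.
Qed.

Lemma tspan_x f : tspan f -> tspan (x * f).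
Proof.
move=> tf; rewrite -[x](subrK 1) mulrDl mul1r; apply: (spanned_modD PD) => //.
by apply: tspanM tf => i j; rewrite mulrA -exprS; apply: tspan_tangent.
Qed.

Lemma tspan_z f : tspan f -> tspan (z * f).
Proof.
move=> tf; rewrite -[z](subrK 1) mulrDl mul1r; apply: (spanned_modD PD) => //.
by apply: tspanM tf => i j; rewrite mulrCA -exprS; apply: tspan_tangent.
Qed.

(** The class of [x] is invertible, since [1 - x] is nilpotent in the quotient:
the finite geometric series in [y = 1 - x] inverts it up to [y ^+ n.+1]. *)
Lemma tspan_x_cancel f : tspan (x * f) -> tspan f.
Proof.
move=> txf; pose y : A := 1 - x.
have ty g : tspan g -> tspan (y * g).
  move=> tg; rewrite mulrBl mul1r -scaleN1r; apply: (spanned_modD PD) => //.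
  exact/(spanned_modZ PZ)/tspan_x.
have -> : f = y ^+ n.+1 * f + \sum_(i < n.+1) y ^+ i * (x * f).
  have e := subrX1 y n.+1; rewrite -mulr_suml.
  have -> : y ^+ n.+1 = (y - 1) * \sum_(i < n.+1) y ^+ i + 1 by rewrite -e subrK.
  rewrite /y; ring.
apply: (spanned_modD PD).
  apply: spanned_mod_base; rewrite mulrC; apply: PM.
  have -> : y = - (x - 1) by rewrite opprB.
  rewrite exprNn; apply: PM.
  by have := @P_exp n.+1 0; rewrite mulr1 addn0; apply.
apply: (spanned_mod_sum P0 PD) => i.
elim: (nat_of_ord i) => [|k IHk]; first by rewrite mul1r.
by rewrite exprS -mulrA; apply: ty.
Qed.

(** A monomial of the cone with [b > a] is not a product of powers of u and uv,
but it becomes one after multiplication by a power of u. *)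
Lemma tspan_exp_cancel k f i j : x ^+ k * f = x ^+ i * z ^+ j -> tspan f.
Proof.
move=> e; suff txf : tspan (x ^+ k * f).
  elim: k txf {e} => [|k IHk]; first by rewrite mul1r.
  by rewrite exprS -mulrA => /tspan_x_cancel.
rewrite e; elim: i {e} => [|i IHi]; last by rewrite exprS -mulrA; apply: tspan_x.
rewrite mul1r; elim: j => [|j IHj]; last by rewrite exprS; apply: tspan_z.
by have := tspan_tangent 0 0; rewrite mulr1.
Qed.
End TangentSpan.

(** * Levels and columns of the cone *)

Definition level (m : sigmaZ) : int := 2 * (sigma_pt m).1 - (sigma_pt m).2.
Definition column (m : sigmaZ) : int := (sigma_pt m).2 - (sigma_pt m).1.

(** The two inequalities are the two facets of the dual cone. *)
Lemma level_bounds m : - level m <= 2 * column m /\ 2 * column m <= level m.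
Proof. by have := sigmaZP m; rewrite /level /column; lia. Qed.

Lemma levelM m m' : level (mmul m m') = level m + level m'.
Proof. by rewrite /level /=; lia. Qed.

Lemma columnM m m' : column (mmul m m') = column m + column m'.
Proof. by rewrite /column /=; lia. Qed.

Lemma sigma_ltE m m' :
  (m < m')%O = (level m < level m') || (level m == level m') && (column m < column m').
Proof.
case: m m' => -[a b] h [[c d] h'].
by rewrite /Order.lt /= /prec /level /column /dotZ /=; lia.
Qed.

Lemma sigma_coord_inj m m' : level m = level m' -> column m = column m' -> m = m'.
Proof.
rewrite /level /column => el ec; apply: val_inj => /=.
by case: (sigma_pt m) (sigma_pt m') el ec => [a b] [c d] /= el ec; congr pair; lia.
Qed.

(** Inverse coordinate change: a = c + w and b = c + 2w.  Outside the cone the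
value is the default [sigma0]. *)
Definition sigma_at (c w : int) : sigmaZ := insubd sigma0 (c + w, c + 2 * w).

Lemma sigma_atK c w : - c <= 2 * w -> 2 * w <= c ->
  level (sigma_at c w) = c /\ column (sigma_at c w) = w.
Proof.
move=> lo up; have dual : in_dual_cone (c + w, c + 2 * w).
  by rewrite /in_dual_cone /dotZ /=; lia.
by rewrite /level /column /sigma_at /= [sigma_pt _](insubdK _ dual) /=; lia.
Qed.

(** * Standard monomials and Newton interpolation *)

Section Staircase.
Variable n : nat.

Definition standard (m : sigmaZ) : bool :=
  (level m <= n%:Z) || (level m == n.+1%:Z) && (column m < 0).

Lemma standard_lt m m' : standard m -> ~~ standard m' -> (m < m')%O.
Proof. by rewrite sigma_ltE /standard; lia. Qed.

Lemma standard_le m m' : (m <= m')%O -> standard m' -> standard m.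
Proof.
move=> le_mm' st; apply: contraLR le_mm' => nst.
by rewrite -ltNge; apply: standard_lt.
Qed.
End Staircase.

(** The columns in the order 0, -1, 1, -2, 2, ..., in which the number of their
standard points decreases by one at each step. *)
Definition nth_column (i : nat) : int :=
  if odd i then - (uphalf i)%:Z else (uphalf i)%:Z.

(** Column w begins at level 2|w|, and [uphalf i] is |w| for [w = nth_column i]. *)
Definition nth_standard (i j : nat) : sigmaZ :=
  sigma_at (2 * uphalf i + j)%N%:Z (nth_column i).

Lemma nth_column_inj : injective nth_column.
Proof. by move=> i k; rewrite /nth_column; case: ifP; case: ifP; lia. Qed.

Lemma nth_standardE i j :
  level (nth_standard i j) = (2 * uphalf i + j)%N%:Z /\
  column (nth_standard i j) = nth_column i.
Proof. by apply: sigma_atK; rewrite /nth_column; case: ifP; lia. Qed.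

Lemma nth_standard_standard n i j : (i + j <= n)%N -> standard n (nth_standard i j).
Proof.
have [el ec] := nth_standardE i j; rewrite /standard el ec /nth_column.
by case: ifP; lia.
Qed.

(** Together with [nth_standard_standard]: the standard points are a triangle in
the coordinates (i, j), which is why there are as many of them as monomials of
degree at most [n] in two variables. *)
Lemma standard_nth n m : standard n m ->
  exists i j, (i + j <= n)%N /\ m = nth_standard i j.
Proof.
move=> st; have [lo up] := level_bounds m.
pose k := (2 * absz (column m) - (column m < 0)%R)%N.
have ek : nth_column k = column m /\ uphalf k = absz (column m).
  by rewrite /nth_column /k; case: ifP; lia.
exists k, (absz (level m) - 2 * absz (column m))%N; split.
  by move: st; rewrite /standard /k; lia.
have [el ec] := nth_standardE k (absz (level m) - 2 * absz (column m))%N.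
apply: sigma_coord_inj; rewrite ?el ?ec ?ek.1 // ek.2; lia.
Qed.

Section Independence.
Variable K : numDomainType.

(** A Newton basis polynomial: it vanishes on the columns before the [i]-th one
and at the first [j] points of that column.  Its values at the points
[nth_standard] form a triangular matrix ([newton_eq0], [newton_neq0]). *)
Definition newton (i j : nat) (m : sigmaZ) : K :=
  (\prod_(k < i) (column m - nth_column k)%:~R) *
  (\prod_(k < j) (level m - (2 * uphalf i + k)%N%:Z)%:~R).

Lemma diffs_vanish_affine (l : sigmaZ -> int) (c : int) :
    (forall m m', l (mmul m m') = l m + l m') ->
  diffs_vanish 2 (fun m => (l m - c)%:~R : K).
Proof.
move=> lM d e m; rewrite -!rmorphB !lM; apply/eqP; rewrite intr_eq0; lia.
Qed.

Lemma diffs_vanish_newton i j : diffs_vanish (i + j).+1 (newton i j).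
Proof.
have := diffs_vanishM
  (diffs_vanish_prod i (fun k => diffs_vanish_affine (nth_column k) columnM))
  (diffs_vanish_prod j (fun k => diffs_vanish_affine (2 * uphalf i + k)%N%:Z levelM)).
by rewrite addSn addnS.
Qed.

Lemma newton_eq0 i j k l : (k < i)%N || (k == i) && (l < j)%N ->
  newton i j (nth_standard k l) = 0.
Proof.
have [el ec] := nth_standardE k l; rewrite /newton ec el.
case: ltnP => [lt_ki _|_ /= /andP[/eqP -> lt_lj]].
  by rewrite (bigD1 (Ordinal lt_ki)) //= subrr !mul0r.
by rewrite (bigD1 (Ordinal lt_lj)) //= subrr mul0r mulr0.
Qed.

Lemma newton_neq0 i j : newton i j (nth_standard i j) != 0.
Proof.
have [el ec] := nth_standardE i j; rewrite /newton ec el mulf_neq0 //.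
  apply/prodf_neq0 => k _; rewrite intr_eq0 subr_eq0.
  by apply/eqP => /nth_column_inj; have := ltn_ord k; lia.
by apply/prodf_neq0 => k _; rewrite intr_eq0; have := ltn_ord k; lia.
Qed.
End Independence.

(** * Normal forms modulo J n *)

Section Groebner.
Variables (R : realType) (n : nat).

Local Notation K := R[i].
Local Notation S := {malg R[i][sigmaZ]}.
Local Notation J := (@J R n).

Lemma J0 : J 0. Proof. exact: ideal_exp0. Qed.

Lemma JD f g : J f -> J g -> J (f + g). Proof. exact: ideal_expD. Qed.

Lemma JM f g : J g -> J (f * g). Proof. exact: ideal_expMl. Qed.

Lemma JZ a f : J f -> J (a *: f).
Proof. by move=> Jf; rewrite -mul_malgC; apply: JM. Qed.

Lemma moment_J (F : sigmaZ -> K) f : diffs_vanish n.+1 F -> J f -> moment F f = 0.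
Proof.
apply: moment_ideal_exp => x; rewrite !inE => /or3P[] /eqP ->; by eexists.
Qed.

(** Otherwise take the last point of the support for the order of columns, then
of levels within a column.  The Newton polynomial of that point vanishes at all
other points of the support, so its moment, which is zero on [J], would be a
nonzero multiple of the coefficient there. *)
Lemma standard_free f : J f -> (forall m, m \in msupp f -> standard n m) -> f = 0.
Proof.
move=> Jf std_f; apply/eqP/negPn/negP => /lm_supp lf.
pose T := ('I_n.+1 * 'I_n.+1)%type.
pose inf (p : T) := (p.1 + p.2 <= n)%N && (nth_standard p.1 p.2 \in msupp f).
have in_inf m : m \in msupp f -> exists2 p, inf p & m = nth_standard p.1 p.2.
  move=> mf; have [i [j [le_ij em]]] := standard_nth (std_f m mf).
  have [lti ltj] : (i < n.+1 /\ j < n.+1)%N by lia.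
  by exists (Ordinal lti, Ordinal ltj); rewrite /inf /= ?le_ij -?em.
have [p0 inf_p0 _] := in_inf _ lf.
(* The weight encodes the lexicographic order, since levels within a column are
   numbered below [n.+1]. *)
case: (arg_maxnP (fun p : T => p.1 * n.+1 + p.2)%N inf_p0) => p /andP[le_p pf] pmax.
have : moment (@newton K p.1 p.2) f = 0.
  by apply: moment_J Jf; apply: diffs_vanishW (diffs_vanish_newton _ _ _).
rewrite momentE (big_fsetD1 _ pf) /= big1_fset => [|m].
  by rewrite addr0 => /eqP; rewrite mulf_eq0 (negPf (newton_neq0 _ _ _)) orbF
     mcoeff_eq0 pf.
rewrite in_fsetD1 => /andP[ne_mp mf] _; have [q inf_q em] := in_inf m mf.
rewrite em newton_eq0 ?mulr0 //.
have := pmax q inf_q => /=.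
have : (q.1 != p.1 :> nat) || (q.2 != p.2 :> nat).
  by rewrite -negb_and; apply: contra ne_mp => /andP[/eqP e1 /eqP e2]; rewrite em e1 e2.
have := ltn_ord p.2; have := ltn_ord q.2.
case: (ltngtP q.1 p.1) => [//|lt_pq|->]; last by rewrite /=; lia.
by have := leq_mul lt_pq (leqnn n.+1); rewrite mulSn; move: (_ * _)%N (_ * _)%N; lia.
Qed.

Local Notation x := (<< mon_u >> : S).
Local Notation z := (<< mon_uv >> : S).

Lemma J_gen_exp i j : (n < i + j)%N -> J ((x - 1) ^+ i * (z - 1) ^+ j).
Proof.
(* Over an arbitrary type, so that no equality test in S is unfolded. *)
have in3 (U : eqType) (a b c : U) : a \in [:: a; b; c] /\ c \in [:: a; b; c].
  by rewrite !inE !eqxx !orbT.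
have [xJ zJ] := in3 S (x - 1) (<< mon_u3v4 >> - 1) (z - 1).
move=> lt_n; apply: (ideal_exp_monomial _ _ lt_n); exact: ideal_span_gen.
Qed.

Lemma malgU_exp (m : sigmaZ) k : exists2 m', << m >> ^+ k = << m' >> :> S &
  level m' = level m * k%:Z /\ column m' = column m * k%:Z.
Proof.
elim: k => [|k [m' em [el ec]]].
  by exists mone => //; rewrite !mulr0.
exists (mmul m m'); first by rewrite malgUX -em exprS.
by rewrite levelM columnM el ec; split; lia.
Qed.

(** With m = (a, b), the identity u^b m = u^a (uv)^b has no negative exponents. *)
Lemma tspan_monomial (m : sigmaZ) :
  spanned_mod J (@tangent K S n << mon_u >> << mon_uv >>) << m >>.
Proof.
have [lo up] := sigmaZP m.
pose a := absz (sigma_pt m).1; pose b := absz (sigma_pt m).2.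
apply: (tspan_exp_cancel J0 JD JM J_gen_exp (k := b) (i := a) (j := b)).
have [mb eb [lb cb]] := malgU_exp mon_u b; have [ma ea [la ca]] := malgU_exp mon_u a.
have [mz ez [lz cz]] := malgU_exp mon_uv b.
rewrite eb ea ez -!malgUX; congr << _ >>.
by apply: sigma_coord_inj; rewrite ?levelM ?columnM ?lb ?cb ?la ?ca ?lz ?cz;
   rewrite /level /column /a /b /=; lia.
Qed.

Let nth_std (t : 'I_#|triangle n|) : sigmaZ :=
  nth_standard (val (enum_val t)).1 (val (enum_val t)).2.

Let nth_std_inj : injective nth_std.
Proof.
move=> s t; rewrite /nth_std => e; apply: enum_val_inj; apply: val_inj.
case: (val (enum_val s)) (val (enum_val t)) e => [i j] [k l] /= e.
have [el ec] := nth_standardE i j; have [el' ec'] := nth_standardE k l.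
have ik : i = k by apply: val_inj; apply: nth_column_inj; rewrite -ec -ec' e.
by congr pair => //; apply: val_inj => /=; move: el el'; rewrite e ik; lia.
Qed.

(** Independence of the standard monomials is turned into spanning by counting:
there are as many as tangent monomials, which span. *)
Lemma normal_form m : exists r : S,
  J (<< m >> - r) /\ forall m', m' \in msupp r -> standard n m'.
Proof.
have std_sum (c : 'rV[K]_#|triangle n|) m' :
    m' \in msupp (\sum_t c 0 t *: << nth_std t >> : S) -> standard n m'.
  apply: contraTT => nst; rewrite -mcoeff_eq0 raddf_sum big1 //= => t _.
  rewrite mcoeffZ mcoeffU1; case: eqP => [e|_]; last by rewrite mulr0.
  by case/negP: nst; rewrite -e; apply: nth_standard_standard; apply: valP (enum_val t).
have [||c Jc] := free_spanned_mod J0 JD JZ (b := fun t => << nth_std t >>) _ _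
    (tspan_monomial m).
- by move=> t; apply: tspan_monomial.
- move=> c /standard_free/(_ (@std_sum c)) c0; apply/rowP => t; rewrite mxE.
  have := congr1 (mcoeff (nth_std t)) c0; rewrite mcoeff0 raddf_sum (bigD1 t) //=.
  rewrite mcoeffZ mcoeffU1 eqxx mulr1 big1 ?addr0 // => s ne_st.
  by rewrite mcoeffZ mcoeffU1 (inj_eq nth_std_inj) (negPf ne_st) mulr0.
by exists (\sum_t c 0 t *: << nth_std t >>); split=> // m'; apply: std_sum.
Qed.

(** * The reduced Groebner basis *)

Definition minimal_nonstandard (m : sigmaZ) : Prop :=
  ~~ standard n m /\ forall d, sdvd d m -> ~~ standard n d -> d = m.

Lemma sdvd_level_lt d m : sdvd d m -> d != m -> level d < level m.
Proof.
move=> [e ->] ne; rewrite levelM; have [lo up] := level_bounds e.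
suff : level e != 0 by lia.
apply: contra ne => /eqP e0; apply/eqP; apply: sigma_coord_inj;
  rewrite ?levelM ?columnM; lia.
Qed.

Lemma minimal_divisor m : ~~ standard n m -> exists2 d, minimal_nonstandard d & sdvd d m.
Proof.
have [k] := ubnP (absz (level m)); elim: k m => // k IHk m lt_k nst.
have [[d [dm nd ne]]|none] :=
  pselect (exists d, [/\ sdvd d m, ~~ standard n d & d != m]).
  have [lo up] := level_bounds d; have lt := sdvd_level_lt dm ne.
  have [|e min_e [c ed]] := IHk d _ nd; first by lia.
  by exists e => //; move: dm => [c' ->]; rewrite ed -mulmA; exists (mmul c c').
exists m; last by exists mone; rewrite mulm1.
split=> // d dm nd; apply/eqP/negPn/negP => ne; by apply: none; exists d.
Qed.

(** Finiteness of the basis.  From level 4 on, u or u^3v^4, both of level 2, can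
be split off a point of the cone; which one depends on the side of column 0.
If the level is at least n + 4, the quotient is still nonstandard. *)
Lemma minimal_level m : minimal_nonstandard m -> level m < n%:Z + 4.
Proof.
move=> [nst min_m]; rewrite ltNge; apply/negP => big.
have [lo up] := level_bounds m.
pose s : int := if 0 < column m then 1 else -1.
have [le ce] : level (sigma_at 2 s) = 2 /\ column (sigma_at 2 s) = s.
  by apply: sigma_atK; rewrite /s; case: ifP; lia.
pose d := sigma_at (level m - 2) (column m - s).
have [ld cd] : level d = level m - 2 /\ column d = column m - s.
  by apply: sigma_atK; rewrite /s; case: ifP; lia.
have dm : sdvd d m.
  exists (sigma_at 2 s); apply: sigma_coord_inj; rewrite ?levelM ?columnM; lia.
have : ~~ standard n d by rewrite /standard ld; lia.
move=> /(min_m _ dm)/(congr1 level); rewrite ld; lia.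
Qed.

Definition low_level (N : nat) : {fset sigmaZ} :=
  seq_fset tt [seq sigma_at c%:Z (w%:Z - N%:Z) | c <- iota 0 N, w <- iota 0 (2 * N)].

Lemma mem_low_level N m : level m < N%:Z -> m \in low_level N.
Proof.
move=> ltN; have [lo up] : - level m <= 2 * column m /\ 2 * column m <= level m.
  exact: level_bounds.
rewrite seq_fsetE.
apply/allpairsP; exists (absz (level m), absz (column m + N%:Z)) => /=.
rewrite !mem_iota; split; try lia.
have [ld cd] := sigma_atK lo up.
apply: sigma_coord_inj; rewrite ?gez0_abs ?addrK ?ld ?cd //; lia.
Qed.

(** The minimal generators of the ideal of leading monomials; [low_level] serves
to make them a finite set. *)
Definition corners : {fset sigmaZ} :=
  [fset m in low_level (n + 4) | `[< minimal_nonstandard m >]].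

Lemma cornersP m : reflect (minimal_nonstandard m) (m \in corners).
Proof.
rewrite !inE /=; apply: (iffP andP) => [[_ /asboolP //]|min_m]; split; last exact/asboolP.
by apply: mem_low_level; have := minimal_level min_m; lia.
Qed.

Lemma lm_eq (f : S) m :
  m \in msupp f -> (forall m', m' \in msupp f -> (m' <= m)%O) -> lm f = m.
Proof.
move=> mf max_m; apply/le_anti; rewrite le_lm // andbT; apply/max_m/lm_supp.
by apply/eqP => f0; rewrite f0 msupp0 in mf.
Qed.

Lemma lm_nonstandard f : J f -> f != 0 -> ~~ standard n (lm f).
Proof.
move=> Jf; apply: contra => std_lm; apply/eqP; apply: standard_free => // m mf.
exact: standard_le (le_lm mf) std_lm.
Qed.

Section NormalForms.
Variable r : sigmaZ -> S.
Hypothesis Jr : forall m, J (<< m >> - r m).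
Hypothesis std_r : forall m m', m' \in msupp (r m) -> standard n m'.

Let g m : S := << m >> - r m.

Lemma mcoeff_corner m m' : ~~ standard n m' -> (g m)@_m' = (m == m')%:R.
Proof.
move=> nst; rewrite mcoeffB mcoeffU1 [(r m)@_m']mcoeff_outdom ?subr0 //.
by apply: contra nst => /std_r.
Qed.

Lemma msupp_corner m m' : m' \in msupp (g m) -> m' = m \/ standard n m'.
Proof.
move=> mg; case: (boolP (standard n m')) => [|nst]; [by right|left].
move: mg; rewrite -mcoeff_neq0 mcoeff_corner //.
by have [->|] := eqVneq m m'; rewrite ?eqxx.
Qed.

Lemma lm_corner m : ~~ standard n m -> lm (g m) = m.
Proof.
move=> nst; apply: lm_eq => [|m' /msupp_corner[->|st]] //.
  by rewrite -mcoeff_neq0 mcoeff_corner // eqxx oner_neq0.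
by apply/ltW/(standard_lt st).
Qed.

Lemma corner_basis : reduced_groebner_basis J [fset g m | m in corners].
Proof.
have g_neq0 m : ~~ standard n m -> g m != 0.
  move=> nst; apply/eqP => /(congr1 (mcoeff m)); rewrite mcoeff_corner // mcoeff0 eqxx.
  by apply/eqP/oner_neq0.
split; first split.
- by move=> _ /imfsetP[m /cornersP[nst _] ->]; split; [apply: g_neq0|apply: Jr].
- move=> f f0 Jf; have [d min_d df] := minimal_divisor (lm_nonstandard Jf f0).
  exists (g d); first by apply/imfsetP; exists d => //; apply/cornersP.
  by rewrite lm_corner //; case: min_d.
- move=> _ /imfsetP[m /cornersP[nst _] ->]; by rewrite /lc lm_corner // mcoeff_corner // eqxx.
move=> _ _ /imfsetP[m /cornersP[nst min_m] ->]
  /imfsetP[d /cornersP[nd _] ->] ne m' m'g.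
rewrite lm_corner // => dm'; have [em|st] := msupp_corner m'g.
  by case/eqP: ne; rewrite (min_m d) -?em.
by case/negP: nd; apply: standard_le (sdvd_le dm') st.
Qed.

(** A function of degree at most [n] that is zero at the standard points other
than [b] reads off the coefficient of [b]: the vanishing moment of
[<< a >> - r a] gives F(a) = (r a)_b F(b). *)
Lemma mem_msupp_corner (F : sigmaZ -> K) a b : diffs_vanish n.+1 F ->
    ~~ standard n a -> standard n b -> F a != 0 ->
    (forall m, standard n m -> m != b -> F m = 0) ->
  b \in msupp (g a).
Proof.
move=> Fn nst st Fa F0; rewrite -mcoeff_neq0 mcoeffB mcoeffU1.
have [ab|_] := eqVneq a b; first by rewrite ab st in nst.
rewrite sub0r oppr_eq0; apply: contra Fa => /eqP rb0.
have := moment_J Fn (Jr a); rewrite momentB momentU mul1r => /eqP.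
rewrite subr_eq0 => /eqP ->; rewrite momentE big_seq big1 // => m /std_r st_m.
have [->|ne] := eqVneq m b; first by rewrite rb0 mul0r.
by rewrite F0 // mulr0.
Qed.
End NormalForms.

(** * The two points of the statement *)

(** Both parities at once: this is p_n for even n and q_n^((n-1)/2) for odd n,
the first point of level n + 2. *)
Definition first_corner : sigmaZ := sigma_at (n.+2)%:Z (- (n.+2./2)%:Z).

Lemma first_cornerE :
  level first_corner = n.+2%:Z /\ column first_corner = - (n.+2./2)%:Z.
Proof. by apply: sigma_atK; lia. Qed.

(** The only candidates for a nonstandard proper divisor are on level n + 1, in
columns w >= 0.  Going up one level leaves the column unchanged, since uv is the
only monomial of level 1, while this point lies in a negative column. *)
Lemma first_corner_minimal : minimal_nonstandard first_corner.
Proof.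
have [la ca] := first_cornerE.
split=> [|d [e eq_a]]; first by rewrite /standard la; lia.
have [lo up] := level_bounds d; have [lo' up'] := level_bounds e.
rewrite eq_a levelM in la; rewrite eq_a columnM in ca.
rewrite eq_a /standard => nd.
by apply: sigma_coord_inj; rewrite ?levelM ?columnM; lia.
Qed.

(** This is s_(n-1) for even n and r_(n-1)^((n-1)/2) for odd n, the last point of
level n. *)
Definition last_standard : sigmaZ := sigma_at n%:Z (n./2)%:Z.

Lemma last_standardE :
  level last_standard = n%:Z /\ column last_standard = (n./2)%:Z.
Proof. by apply: sigma_atK; lia. Qed.

(** For even n the point [last_standard] is alone in the last visited column, and
a product of n column equations isolates it.  For odd n it is the second of the
two points of the last but one column, and one more column, with a single point,
follows: n - 1 column equations leave three points, and the last factor is the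
equation of the line through the other two. *)
Lemma separating_function : exists F : sigmaZ -> K,
  [/\ diffs_vanish n.+1 F, F first_corner != 0 &
      forall m, standard n m -> m != last_standard -> F m = 0].
Proof.
have [la ca] := first_cornerE; have [lb cb] := last_standardE.
have newton_a k : (k <= n)%N -> newton K k 0 first_corner != 0.
  move=> le_k; rewrite /newton big_ord0 mulr1; apply/prodf_neq0 => i _.
  rewrite intr_eq0 ca /nth_column; have := ltn_ord i; case: ifP; lia.
have last_eq m : level m = n%:Z -> column m = (n./2)%:Z -> m = last_standard.
  by move=> lev col; apply: sigma_coord_inj; rewrite ?lb ?cb.
case: (boolP (odd n)) => [odd_n|even_n].
  (* The line n c + 2 w = n^2 - 1 passes through (n-1, (n-1)/2) and
     (n+1, -(n+1)/2), the standard points that remain to be avoided. *)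
  pose l m : int := n%:Z * level m + 2 * column m.
  pose c : int := n%:Z * n%:Z - 1.
  have lM m m' : l (mmul m m') = l m + l m' by rewrite /l levelM columnM; lia.
  exists (fun m => newton K n.-1 0 m * (l m - c)%:~R); split.
  - have := diffs_vanishM (diffs_vanish_newton K n.-1 0) (diffs_vanish_affine K c lM).
    by rewrite addn0 addn2 succnK prednK //; lia.
  - rewrite mulf_neq0 ?newton_a //; first by lia.
    by rewrite intr_eq0 /l /c la ca; nia.
  move=> m /standard_nth[i [j [le_ij em]]] ne.
  have [lev col] := nth_standardE i j; rewrite -em /nth_column in lev col.
  have [lt_i|ge_i] := ltnP i n.-1; first by rewrite em newton_eq0 ?mul0r // lt_i.
  suff -> : l m - c = 0 by rewrite mulr0.
  have [j0 ei] : j = 0%N /\ (i = n.-1 \/ i = n).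
    suff : ~ (i = n.-1 /\ j = 1%N) by lia.
    move=> [ei j1]; case/eqP: ne; move: lev col; rewrite ei j1 => lev col.
    by apply: last_eq; move: lev col; case: ifP; lia.
  have [h eh] : exists h, n = h.*2.+1 by exists n./2; lia.
  have [[em1 ec1]|[em1 ec1]] : level m = 2 * h%:Z /\ column m = h%:Z \/
      level m = 2 * h%:Z + 2 /\ column m = - h%:Z - 1.
  - by move: lev col; case: ei => ->; rewrite eh j0; case: ifP; lia.
  - by rewrite /l /c em1 ec1 eh; lia.
  - by rewrite /l /c em1 ec1 eh; lia.
exists (newton K n 0); split; rewrite ?newton_a //.
  by have := diffs_vanish_newton K n 0; rewrite addn0.
move=> m /standard_nth[i [j [le_ij em]]] ne.
have [lev col] := nth_standardE i j; rewrite -em /nth_column in lev col.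
have [lt_i|ge_i] := ltnP i n; first by rewrite em newton_eq0 // lt_i.
have [ei j0] : i = n /\ j = 0%N by lia.
case/eqP: ne; rewrite ei j0 in lev col.
by apply: last_eq; move: lev col; case: ifP; lia.
Qed.

Lemma marked_first_corner : exists2 g : S,
  marked_groebner_basis J (g, first_corner) & last_standard \in msupp g.
Proof.
have [r rP] := choice normal_form.
have Jr m := (rP m).1; have std_r m := (rP m).2.
have [F [Fn Fa F0]] := separating_function.
have [nst _] := first_corner_minimal; have [lb cb] := last_standardE.
exists (<< first_corner >> - r first_corner).
  exists [fset << m >> - r m | m in corners]; split; first exact: corner_basis.
    by apply/imfsetP; exists first_corner => //; apply/cornersP/first_corner_minimal.
  by rewrite /= lm_corner.
apply: (mem_msupp_corner Jr std_r Fn) => //; by rewrite /standard lb lexx.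
Qed.
End Groebner.

Lemma mulrn_pair (a b : int) k : ((a, b) *+ k : int * int) = (a * k%:Z, b * k%:Z).
Proof.
by elim: k => [|k IHk]; rewrite ?mulr0n ?mulr0 // mulrS IHk; congr pair => /=; lia.
Qed.

Lemma sigma_pt_coord m : sigma_pt m = (level m + column m, level m + 2 * column m).
Proof. by rewrite /level /column; case: (sigma_pt m) => a b /=; congr pair; lia. Qed.

Theorem lemma2p17 (R : realType) (n : nat) (hn : (2 <= n)%N) :
  exists (g : {malg R[i][sigmaZ]}) (alpha : sigmaZ),
    marked_groebner_basis (@J R n) (g, alpha) /\
    if odd n
    then sigma_pt alpha = pt_q n (n - 1)./2 /\
         pt_r (n - 1) (n - 1)./2 \in supp g
    else sigma_pt alpha = pt_p n /\ pt_s (n - 1) \in supp g.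
Proof.
have [g marked_g beta_g] := marked_first_corner R n.
exists g, (first_corner n); split=> //.
have mem_supp p : sigma_pt (last_standard n) = p -> p \in supp g.
  by move=> <-; apply: in_imfset.
have [la ca] := first_cornerE n; have [lb cb] := last_standardE n.
case: ifP => odd_n; split.
- rewrite sigma_pt_coord la ca /pt_q /pt_q0 odd_n mulrn_pair /=.
  by apply: injective_projections => /=; lia.
- apply: mem_supp; rewrite sigma_pt_coord lb cb /pt_r /pt_r0 /pt_q0 ifF; last by lia.
  by rewrite !mulrn_pair /=; apply: injective_projections => /=; lia.
- rewrite sigma_pt_coord la ca /pt_p odd_n /=.
  by apply: injective_projections => /=; lia.
- apply: mem_supp; rewrite sigma_pt_coord lb cb /pt_s ifT; last by lia.
  by rewrite mulrn_pair /=; apply: injective_projections => /=; lia.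
Qed.
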